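(* Let $\xi$ be an irrational real number and let $(p_k/q_k)_{k\ge 0}$ be the sequence of its convergents. Assume that the series $$ \sum_{k\ge 0}\frac{1}{\max(1,\log q_k)} $$ diverges. Then for almost every real number $y$ (with respect to Lebesgue measure) there exist infinitely many primitive points $(p,q)$ satisfying $$ |q\xi+p-y|\le\frac{2}{|q|}. $$ Moreover, the series $\sum_{k\ge 0}\frac{1}{\max(1,\log q_k)}$ (formed with the denominators $q_k$ of the convergents of $\xi$) diverges for almost every real number $\xi$.
   Context: The convergents $p_k/q_k$ of $\xi$ are those of its regular (simple) continued fraction expansion, written in lowest terms with $q_k\ge 1$. A primitive point is a pair $(p,q)\in\mathbb{Z}^2$ with $\gcd(p,q)=1$; in the displayed inequality $q\neq 0$. *)

(* Defs.v *)
From HB Require Import structures.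
From mathcomp Require Import all_boot all_order all_algebra.
From mathcomp Require Import all_classical all_reals all_analysis.

Set Implicit Arguments.
Unset Strict Implicit.
Unset Printing Implicit Defensive.

Import Order.TTheory GRing.Theory Num.Theory.
Import numFieldNormedType.Exports.
Local Open Scope classical_set_scope.
Local Open Scope ring_scope.

(* For irrational xi these are the x_k of the expansion
   xi = a_0 + 1 / (a_1 + 1 / (... + 1 / x_k)).  For rational xi the expansion
   stops at the first integral x_k; since 0^-1 = 0, all later terms are 0. *)
Definition complete_quotient (R : realType) (xi : R) (k : nat) : R :=
  iter k (fun x => (x - (Num.floor x)%:~R)^-1) xi.

Definition partial_quotient (R : realType) (xi : R) (k : nat) : int :=
  Num.floor (complete_quotient xi k).

(* cf_value [:: a_0; ...; a_k] = a_0 + 1 / (a_1 + 1 / (... + 1 / a_k)); the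
   seed 0 contributes nothing because 0^-1 = 0. *)
Definition cf_value (s : seq int) : rat :=
  foldr (fun (a : int) (v : rat) => a%:~R + v^-1) 0 s.

(* For rational xi this sequence is eventually constant, equal to xi. *)
Definition convergent (R : realType) (xi : R) (k : nat) : rat :=
  cf_value (mkseq (partial_quotient xi) k.+1).

(* denq is the positive denominator in lowest terms. *)
Definition convergent_den (R : realType) (xi : R) (k : nat) : int :=
  denq (convergent xi k).

Definition inv_log_den (R : realType) (xi : R) (k : nat) : R :=
  (Num.max 1 (ln (convergent_den xi k)%:~R))^-1.

Definition primitive_point (pq : int * int) : bool := coprimez pq.1 pq.2.

(* Main.v *)
Require Import Defs.
From HB Require Import structures.
From mathcomp Require Import all_boot all_order all_algebra.
From mathcomp Require Import all_classical all_reals all_analysis.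
From mathcomp Require Import ring lra zify.
Set Implicit Arguments.
Unset Strict Implicit.
Unset Printing Implicit Defensive.
Import Order.TTheory GRing.Theory Num.Theory.
Import numFieldNormedType.Exports.
Local Open Scope ring_scope.

(** Approximation.  Fix an irrational $\xi$ and write $x = q \xi + p$ for an
    integer point $(p, q)$.  It is enough to find one constant $c > 0$ such that
    in every interval $(u, v)$ avoiding 0 the numbers $y$ within $2 / q$ of some
    $x$ with $(p, q)$ primitive and $q$ beyond a given bound $T$ fill a proportion
    at least $c$: by the Lebesgue density theorem almost every $y$ is then
    approximable beyond every $T$ ([ae_notin_of_density_lt1]), and solutions with
    arbitrarily large $q$ are infinitely many.

    Such a proportion is obtained by counting ([many_primitive_points]).  Let
    $a / b$ be a convergent of $\xi$ and $m = q a + p b$, so that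
    $x = m / b + q (\xi - a / b)$.  If $q \le e$ and $e |\xi - a / b|$ is small,
    $x$ lies in $(u, v)$ as soon as $m / b$ lies in its middle half.  On each of
    the about $b (v - u) / 2$ lines given by such an $m$, there is one point in
    every $b$ consecutive values of $q$.  An integer $r \ge 2$ divides both $p$
    and $q$ for about $1 / r^2$ of these points, because it then divides $m$, and
    $m / r$ determines $q$ modulo $r b$.  As $\sum_{r \ge 2} 1 / r^2 < 1$ a
    positive proportion of the points is primitive, provided that the rounding
    errors are negligible.  Since $m \ne 0$ only $r = O(b)$ occur, and the errors
    are negligible as soon as $e$ exceeds $b$ by a small power of $b$.  Finally,
    for $e$ the denominator of another convergent, the values $x$ with $q < e / 2$
    are at distance at least $1 / (2 e)$ from each other ([form_separated]), so
    the intervals of length $1 / (2 e)$ around them are disjoint and their total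
    length is the number of points times $1 / (2 e)$.  The two convergents are
    chosen in [two_scales].

    Divergence.  Let $A_j = ((j + 1)!)^2$.  If a denominator $q_k \le A_j$ is
    followed by $q_{k+1} \ge A_{j+1}$, then $\xi$ is within $1 / (q_k A_{j+1})$ of
    $p_k / q_k$; in a bounded interval such $\xi$ form a set of measure
    $O(A_j / A_{j+1}) = O(1 / (j + 2)^2)$.  By the Borel-Cantelli lemma almost
    every $\xi$ has, for all large $j$, a denominator between $A_j$ and
    $A_{j+1}$.  As $\log A_{j+1} \le 2 (j + 2) \log (j + 2)$, the series dominates
    $\sum 1 / (2 r \log r)$, which diverges like $\log \log r$. *)

(** * Convergents of an irrational number *)

(** Consecutive terms $(x_{k-1}, x_k)$ of the recurrence
    $x_k = a_k x_{k-1} + x_{k-2}$. *)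
Fixpoint continuants (a : nat -> int) (u v : int) (k : nat) : int * int :=
  if k is k'.+1 then
    let st := continuants a u v k' in (st.2, a k * st.2 + st.1)
  else (u, v).

Definition cf_num (a : nat -> int) := continuants a 1 (a 0).
Definition cf_den (a : nat -> int) := continuants a 0 1.

(** Replacing the seed $v$ by $b + 1 / v$ is multiplication by an integer matrix,
    and the recurrence of [continuants] is the product of these matrices.  The
    rational value of a convergent and the real expansion of a number with its
    complete quotient as the last entry are both instances. *)
Lemma foldr_cf (F : numFieldType) (a : nat -> int) (k : nat) (v : F) :
  (forall j, 0 < a j.+1) -> 0 < v ->
  foldr (fun (b : int) (w : F) => b%:~R + w^-1) v (mkseq a k.+1) =
  ((cf_num a k).2%:~R * v + (cf_num a k).1%:~R) /
  ((cf_den a k).2%:~R * v + (cf_den a k).1%:~R).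
Proof.
move=> a0; elim: k v => [|k IH] v v0.
  by rewrite /=; field; rewrite gt_eqF.
rewrite mkseqS foldr_rcons IH; last first.
  by rewrite addr_gt0 ?invr_gt0// ltr0z a0.
rewrite /= !rmorphD !rmorphM /=.
have -> (A B : F) (c : F) : (A * (c + v^-1) + B) = ((A * c + B) * v + A) / v.
  by field; rewrite gt_eqF.
have -> (A B : F) (c : F) : (A * (c + v^-1) + B) = ((A * c + B) * v + A) / v.
  by field; rewrite gt_eqF.
rewrite invfM invrK mulrACA mulVf ?gt_eqF// mulr1.
by rewrite ![(a k.+1)%:~R * _]mulrC.
Qed.

Lemma cf_det (a : nat -> int) (k : nat) :
  (cf_num a k).2 * (cf_den a k).1 - (cf_num a k).1 * (cf_den a k).2 =
  (-1) ^+ k.+1.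
Proof.
elim: k => [|k IH] /=; first by rewrite mulr0 mul1r sub0r expr1.
by rewrite exprS -IH /cf_num /cf_den; ring.
Qed.

Lemma cf_den_ge (a : nat -> int) (k : nat) : (forall j, 0 < a j.+1) ->
  [/\ 0 <= (cf_den a k).1, 0 < (cf_den a k).2 & k%:Z <= (cf_den a k).2].
Proof.
move=> a0; suff: [/\ 0 <= (cf_den a k).1, 0 < (cf_den a k).2,
    k%:Z <= (cf_den a k).2 & (0 < k)%N -> 0 < (cf_den a k).1] by case.
elim: k => [//|k [h1 h2 h3 h4]] /=.
have := a0 k; rewrite /cf_den /= in h1 h2 h3 h4 * => ak.
split; [exact: ltW|nia|by case: k h1 h2 h3 h4 ak => [|k]; [lia|nia]|by []].
Qed.

Section irrational_convergents.
Context {R : realType} (xi : R) (xi_irr : irrational xi).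

Let a := partial_quotient xi.
Let x := complete_quotient xi.

Lemma complete_quotientS k : x k.+1 = (x k - (a k)%:~R)^-1.
Proof. by rewrite /x /complete_quotient iterS. Qed.

Lemma complete_quotient_irrational k : irrational (x k).
Proof.
elim: k => [//|k IH]; rewrite complete_quotientS => -[r _ rE]; apply: IH.
exists (r^-1 + (a k)%:~R) => //.
by rewrite rmorphD fmorphV /= ratr_int rE invrK subrK.
Qed.

Lemma complete_quotient_gt1 k : 1 < x k.+1.
Proof.
rewrite complete_quotientS.
have /andP[h1 h2] : (a k)%:~R <= x k < (a k + 1)%:~R.
  by rewrite floor_le floorD1_gt.
have h3 : (a k)%:~R != x k.
  apply/eqP => e; apply: (@complete_quotient_irrational k).
  by exists (a k)%:~R; rewrite // ratr_int.
have h4 : 0 < x k - (a k)%:~R by rewrite subr_gt0 lt_neqAle h3.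
rewrite -[ltLHS]invr1 ltf_pV2 ?posrE// ltrBlDl.
by rewrite -(intrD _ (a k) 1).
Qed.

Lemma partial_quotient_gt0 k : 0 < a k.+1.
Proof. by rewrite floor_gt0 ltW// complete_quotient_gt1. Qed.

Lemma complete_quotientE k : xi =
  foldr (fun (b : int) (w : R) => b%:~R + w^-1) (x k.+1) (mkseq a k.+1).
Proof.
elim: k => [|k IH]; first by rewrite complete_quotientS /= invrK addrC subrK.
by rewrite mkseqS foldr_rcons (complete_quotientS k.+1) invrK addrC subrK.
Qed.

Let p k := (cf_num a k).2.
Let q k := (cf_den a k).2.

Lemma cf_den_gt0 k : 0 < q k.
Proof. by have [] := cf_den_ge k partial_quotient_gt0. Qed.

Lemma convergentE k : convergent xi k = (p k)%:~R / (q k)%:~R.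
Proof.
rewrite /convergent /cf_value; case: k => [|k].
  by rewrite /= invr0 addr0 /q /= divr1.
rewrite mkseqS foldr_rcons invr0 addr0 foldr_cf ?ltr0z//; last first.
- exact: partial_quotient_gt0.
- exact: partial_quotient_gt0.
by rewrite /p /q /= !rmorphD !rmorphM /= ![(a _)%:~R * _]mulrC.
Qed.

Lemma convergent_coprime k : coprimez (p k) (q k).
Proof.
apply/coprimezP.
exists ((-1) ^+ k.+1 * (cf_den a k).1, - (-1) ^+ k.+1 * (cf_num a k).1) => /=.
transitivity ((-1) ^+ k.+1 * ((cf_num a k).2 * (cf_den a k).1 -
    (cf_num a k).1 * (cf_den a k).2)); first by rewrite /p /q; ring.
by rewrite cf_det -expr2 sqrr_sign.
Qed.

Lemma convergent_denE k : convergent_den xi k = q k.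
Proof.
rewrite /convergent_den convergentE coprimeq_den; last exact: convergent_coprime.
have q0 := cf_den_gt0 k.
by rewrite gt_eqF// gtr0_norm.
Qed.

Lemma convergent_numE k : numq (convergent xi k) = p k.
Proof.
rewrite convergentE coprimeq_num; last exact: convergent_coprime.
by rewrite gtr0_sg ?mul1r// cf_den_gt0.
Qed.

(** The error of a convergent is exactly
    $1 / (q_k (x_{k+1} q_k + q_{k-1}))$, and $x_{k+1} \ge a_{k+1}$. *)
Lemma convergent_approx k :
  `|xi - (numq (convergent xi k))%:~R / (convergent_den xi k)%:~R| <=
  ((convergent_den xi k)%:~R * (convergent_den xi k.+1)%:~R)^-1.
Proof.
rewrite !convergent_denE convergent_numE.
have [q'0 q0 _] := cf_den_ge k partial_quotient_gt0.
have x1 := complete_quotient_gt1 k.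
have x0 : 0 < x k.+1 by rewrite (lt_trans _ x1).
have Q0 : 0 < (q k)%:~R :> R by rewrite ltr0z.
have D0 : 0 < (q k)%:~R * x k.+1 + (cf_den a k).1%:~R.
  by rewrite ltr_wpDr ?ler0z// mulr_gt0.
rewrite {1}(complete_quotientE k) foldr_cf//; last exact: partial_quotient_gt0.
rewrite -/(p k) -/(q k).
have -> : ((p k)%:~R * x k.+1 + (cf_num a k).1%:~R) /
    ((q k)%:~R * x k.+1 + (cf_den a k).1%:~R) - (p k)%:~R / (q k)%:~R =
  - ((p k * (cf_den a k).1 - (cf_num a k).1 * q k)%:~R /
     ((q k)%:~R * ((q k)%:~R * x k.+1 + (cf_den a k).1%:~R))).
  by field; rewrite !gt_eqF.
rewrite cf_det normrN normrM normfV rmorphXn rmorphN1 normrX normrN1 expr1n mul1r.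
rewrite ger0_norm ?mulr_ge0 ?(ltW D0) ?(ltW Q0)//.
rewrite lef_pV2 ?posrE ?mulr_gt0 ?ltr0z ?cf_den_gt0//.
rewrite ler_pM2l ?ltr0z// /q /= rmorphD rmorphM /= lerD2r mulrC.
by rewrite ler_pM2l// floor_le.
Qed.

Lemma convergent_den_ge k : k%:Z <= convergent_den xi k.
Proof.
by rewrite convergent_denE; have [] := cf_den_ge k partial_quotient_gt0.
Qed.

Lemma convergent_den_le k : convergent_den xi k <= convergent_den xi k.+1.
Proof.
rewrite !convergent_denE /q /=.
have [q'0 q0 _] := cf_den_ge k partial_quotient_gt0.
have := partial_quotient_gt0 k; rewrite /cf_den in q0 q'0 *; nia.
Qed.

End irrational_convergents.

Definition convergent_denn (R : realType) (xi : R) (k : nat) : nat :=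
  `|convergent_den xi k|%N.

Section convergent_denn_theory.
Context {R : realType} (xi : R).

Local Notation p k := (numq (convergent xi k)).
Local Notation q := (convergent_denn xi).

Lemma convergent_dennE k : (q k : int) = convergent_den xi k.
Proof. by rewrite gez0_abs// ltW// denq_gt0. Qed.

Lemma convergent_denn_gt0 k : (0 < q k)%N.
Proof. by rewrite absz_gt0 gt_eqF// denq_gt0. Qed.

Lemma convergent_denn_coprime k : coprimez (p k) (q k).
Proof. by rewrite convergent_dennE; exact: coprime_num_den. Qed.

Context (xi_irr : irrational xi).

Lemma convergent_denn_ge k : (k <= q k)%N.
Proof. by rewrite -lez_nat convergent_dennE convergent_den_ge. Qed.

Lemma convergent_denn_mono m n : (m <= n)%N -> (q m <= q n)%N.
Proof.
apply: (@homo_leq _ q leq) => // [? ? ?|k]; first exact: leq_trans.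
by rewrite -lez_nat !convergent_dennE convergent_den_le.
Qed.

Lemma convergent_denn_approx k :
  `|xi - (p k)%:~R / (q k)%:R| <= ((q k)%:R * (q k.+1)%:R)^-1.
Proof.
by have := convergent_approx xi_irr k; rewrite -!convergent_dennE -!pmulrn.
Qed.

End convergent_denn_theory.

(** * Counting coprime points on a family of parallel lines *)

Lemma card_congruent (K d : nat) (A : {set 'I_K}) : (0 < d)%N ->
  {in A &, forall i j : 'I_K, (i = j %[mod d])%N} -> (#|A| <= K %/ d + 1)%N.
Proof.
move=> d0 Amod; rewrite addn1 -[leqRHS]card_ord.
pose f (i : 'I_K) : 'I_(K %/ d).+1 := inord (i %/ d).
apply: (@leq_card_in _ _ f) => i j iA jA /(congr1 val) /=.
rewrite !inordK ?ltnS ?leq_div2r 1?ltnW// => eq_div.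
apply: val_inj => /=.
by rewrite (divn_eq i d) (divn_eq j d) eq_div (Amod i j).
Qed.

Lemma card_solutions (a m n : int) (b N : nat) : (0 < b)%N -> coprimez a b ->
  (N %/ b <= #|[set j : 'I_N | (b %| (m - (n + j%:Z) * a)%R)%Z]|)%N.
Proof.
move=> b0 /coprimezP[[s t] /= st1].
have b0' : (b%:Z != 0)%R by lia.
pose j0 := `|((s * m - n) %% b)%Z|%N.
have j0E : (j0 : int) = ((s * m - n) %% b)%Z by rewrite /j0 gez0_abs// modz_ge0.
have j0b : (j0 < b)%N by rewrite -ltz_nat j0E ltz_pmod.
have lt_tj (i : 'I_(N %/ b)) : (i * b + j0 < N)%N.
  rewrite (leq_trans _ (leq_divM N b))//.
  rewrite (@leq_trans (i.+1 * b))// ?leq_mul2r ?ltn_ord ?orbT//.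
  by rewrite mulSn addnC ltn_add2r.
pose f i := Ordinal (lt_tj i).
rewrite -[leqLHS]card_ord -(@card_imset _ _ f).
  apply/subset_leq_card/fintype.subsetP => _ /imsetP[i _ ->]; rewrite inE /=.
  have : (b %| (s * m - n) - j0%:Z)%Z.
    by rewrite j0E {1}(divz_eq (s * m - n) b) addrK dvdz_mull.
  move=> /dvdzP[w wE].
  apply/dvdzP; exists (t * m + w * a - i%:Z * a).
  rewrite PoszD PoszM -[X in X - _]mul1r -st1.
  have -> : n = s * m - j0%:Z - w * b by lia.
  ring.
move=> i j /(congr1 val) /= /eqP.
rewrite eqn_add2r eqn_mul2r => /orP[/eqP b00|/eqP]; last exact: val_inj.
by rewrite b00 in b0.
Qed.

Lemma card_fibers (I J : finType) (B : {set I * J}) :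
  #|B| = (\sum_(i : I) #|[set j | (i, j) \in B]|)%N.
Proof.
rewrite -sum1_card (eq_bigr (fun ij => (fun _ _ => 1%N) ij.1 ij.2))//.
rewrite (eq_bigl (fun ij => true && ((ij.1, ij.2) \in B))); last by case.
rewrite -(pair_big_dep predT (fun i j => (i, j) \in B) (fun _ _ => 1%N)) /=.
by apply: eq_bigr => i _; rewrite -sum1_card; apply: eq_bigl => j; rewrite inE.
Qed.

Lemma card_fibers_le (I J : finType) (B : {set I * J}) (A : {set I}) (c : nat) :
  (forall i j, (i, j) \in B -> i \in A) ->
  (forall i, (#|[set j | (i, j) \in B]| <= c)%N) ->
  (#|B| <= #|A| * c)%N.
Proof.
move=> BA Bc; rewrite card_fibers -sum_nat_const [leqRHS]big_mkcond.
apply: leq_sum => i _; case: ifPn => // iA; rewrite leqn0 cards_eq0.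
by apply/eqP/setP => j; rewrite !inE; apply: contraNF iA; exact: BA.
Qed.

Section coprime_points.
Context (a m0 : int) (b N K M : nat).
Context (b0 : (0 < b)%N) (N0 : (0 < N)%N) (ab : coprimez a b).
Context (m_bound : forall i : 'I_K, (0 < `|(m0 + i%:Z)%R| <= M)%N).

Let m (i : 'I_K) : int := m0 + i%:Z.

(** The integer points $(p, q)$ with $N \le q < 2 N$ on the lines
    $q a + p b = m_0 + i$, $i < K$, indexed by $(i, j)$ with $q = N + j$.  On such
    a line $q$ is confined to one class modulo $b$; for $(i, j)$ outside
    [line_points] the value of [line_p] is meaningless. *)
Definition line_q (j : 'I_N) : int := N%:Z + j%:Z.
Definition line_p (i : 'I_K) (j : 'I_N) : int :=
  ((m0 + i%:Z - line_q j * a) %/ b)%Z.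
Definition line_points : {set 'I_K * 'I_N} :=
  [set ij : 'I_K * 'I_N | (b %| m0 + ij.1%:Z - line_q ij.2 * a)%Z].
Definition line_primitive : {set 'I_K * 'I_N} :=
  [set ij in line_points | coprimez (line_p ij.1 ij.2) (line_q ij.2)].

Let multiples (r : nat) : {set 'I_K * 'I_N} :=
  [set ij in line_points |
     (r %| line_p ij.1 ij.2)%Z && (r %| line_q ij.2)%Z].

Lemma line_pE i j : (i, j) \in line_points ->
  line_p i j * b%:Z = m0 + i%:Z - line_q j * a.
Proof. by rewrite inE => /divzK. Qed.

Lemma card_line_points : (K * (N %/ b) <= #|line_points|)%N.
Proof.
rewrite card_fibers -{1}[K]card_ord -sum_nat_const; apply: leq_sum => i _.
apply: leq_trans (card_solutions (m i) N%:Z N b0 ab) _.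
by apply/subset_leq_card/fintype.subsetP => j; rewrite !inE.
Qed.

(** If $r$ divides $p$ and $q$ it divides $m = q a + p b$, which leaves one line
    out of $r$; on that line $m / r$ fixes $q / r$ modulo $b$, hence $q$ modulo
    $r b$. *)
Lemma card_multiples (r : nat) : (0 < r)%N ->
  (#|multiples r| <= (K %/ r + 1) * (N %/ (r * b) + 1))%N.
Proof.
move=> r0.
have rb0 : (0 < r * b)%N by rewrite muln_gt0 r0.
have rN0 : r%:Z != 0 by rewrite eqz_nat -lt0n.
pose A := [set i : 'I_K | (r %| m i)%Z].
have in_mult i j : (i, j) \in multiples r ->
    ((r * b)%N %| m i - line_q j * a)%Z /\ (r %| line_q j)%Z.
  rewrite inE => /andP[ijS /andP[/= rp rq]]; split=> //.
  by rewrite /m -(line_pE ijS) PoszM dvdz_mul.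
have dr i j : (i, j) \in multiples r -> i \in A.
  move=> /in_mult[h rq]; rewrite inE -(subrK (line_q j * a) (m i)).
  rewrite rpredD//; first by apply: (dvdz_trans _ h); rewrite PoszM dvdz_mulr.
  by rewrite dvdz_mulr.
apply: (leq_trans (card_fibers_le (c := (N %/ (r * b) + 1)%N) dr _)).
  move=> i; apply: card_congruent => // j1 j2; rewrite !inE.
  move=> j1S j2S.
  have /in_mult[h1 rq1] : (i, j1) \in multiples r by rewrite !inE.
  have /in_mult[h2 rq2] : (i, j2) \in multiples r by rewrite !inE.
  suff: ((r * b)%N %| j1%:Z - j2%:Z)%Z.
    by move=> h; apply/eqP; rewrite -eqz_nat -!modz_nat -eqz_mod_dvd in h *.
  have -> : j1%:Z - j2%:Z = line_q j1 - line_q j2 by rewrite /line_q; ring.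
  have /dvdzP[w wE] : (r %| line_q j1 - line_q j2)%Z by rewrite rpredB.
  have : ((r * b)%N %| (m i - line_q j2 * a) - (m i - line_q j1 * a))%Z.
    by rewrite rpredB.
  have -> : (m i - line_q j2 * a) - (m i - line_q j1 * a) = (w * a) * r.
    by rewrite -mulrAC -wE; ring.
  rewrite wE PoszM ![_ * r%:Z]mulrC !dvdz_mul2l//.
  by rewrite Gauss_dvdzl// coprimez_sym.
rewrite leq_mul2r; apply/orP; right; apply: card_congruent => // i1 i2.
rewrite !inE => h1 h2.
apply/eqP; rewrite -eqz_nat -!modz_nat eqz_mod_dvd.
by rewrite (_ : _ - _ = m i1 - m i2) ?rpredB// /m; ring.
Qed.

(** A common divisor of $p$ and $q$ divides $m \ne 0$, so it is at most $M$. *)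
Lemma card_line_primitive :
  (K * (N %/ b) <=
   #|line_primitive| + \sum_(2 <= r < M.+1) (K %/ r + 1) * (N %/ (r * b) + 1))%N.
Proof.
apply: (leq_trans card_line_points).
apply: (@leq_trans (#|line_primitive| + \sum_(2 <= r < M.+1) #|multiples r|)%N).
  pose U := \bigcup_(r : 'I_M.+1 | (1 < r)%N) multiples r.
  apply: (@leq_trans #|line_primitive :|: U|).
    apply/subset_leq_card/fintype.subsetP => -[i j] ijS.
    rewrite finset.in_setU; case: (boolP (_ \in line_primitive)) => //=.
    rewrite inE ijS /= => ncop.
    set g := gcdn `|line_p i j| `|line_q j|.
    have gp : (g %| line_p i j)%Z by rewrite dvdzE /= dvdn_gcdl.
    have gq : (g %| line_q j)%Z by rewrite dvdzE /= dvdn_gcdr.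
    have gm : (g %| m i)%Z.
      by rewrite -(subrK (line_q j * a) (m i)) rpredD// ?dvdz_mulr// /m -line_pE// dvdz_mulr.
    have gM : (g < M.+1)%N.
      have /andP[mi0 miM] := m_bound i.
      by rewrite ltnS (leq_trans _ miM)// dvdn_leq.
    apply/finset.bigcupP; exists (Ordinal gM) => /=; last by rewrite inE ijS gp gq.
    have g0 : (0 < g)%N by rewrite gcdn_gt0 orbC; apply/orP; left; rewrite /line_q; lia.
    by rewrite ltn_neqAle g0 andbT eq_sym; move: ncop; rewrite /coprimez /gcdz.
  apply: (leq_trans (leq_card_setU _ _)); rewrite leq_add2l.
  rewrite big_geq_mkord /U.
  elim/big_rec2: _ => [|r s B _ IH]; first by rewrite cards0.
  by apply: (leq_trans (leq_card_setU _ _)); rewrite leq_add2l.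
rewrite leq_add2l big_nat_cond [X in (_ <= X)%N]big_nat_cond.
by apply: leq_sum => r /andP[/andP[r2 _] _]; apply: card_multiples; lia.
Qed.

End coprime_points.

(** * Quantitative form of the count *)

Section numeric_sums.
Context {R : rcfType}.

Lemma sum_inv_sqr_le (M : nat) :
  \sum_(2 <= r < M.+1) r%:R^-1 ^+ 2 <= 3 / 4 :> R.
Proof.
suff H (n : nat) : \sum_(2 <= r < n.+3) r%:R^-1 ^+ 2 <= 3 / 4 - n.+2%:R^-1 :> R.
  case: M => [|[|M]]; try by rewrite big_geq//; lra.
  by apply: (le_trans (H M)); rewrite gerBl invr_ge0.
elim: n => [|n IH]; first by rewrite big_nat1; lra.
rewrite big_nat_recr//=; apply: (le_trans (lerD IH (lexx _))).
have n0 : (0 : R) < n.+2%:R by rewrite ltr0n.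
rewrite -[n.+3%:R]natr1; set x : R := n.+2%:R in n0 *.
set y := (x + 1)^-1; set z := x^-1.
suff : 0 <= z - y - y ^+ 2 by lra.
have -> : z - y - y ^+ 2 = z * y ^+ 2.
  by rewrite /z /y; field; rewrite !gt_eqF// ltr_wpDr.
by rewrite mulr_ge0 ?exprn_ge0 ?invr_ge0 ?ltW// /y ltr_wpDr.
Qed.

(** In the count below $M = O(b)$, and this sum multiplies quantities smaller than
    the main term by a factor $b^{1/3}$: a fourth root is an affordable bound. *)
Lemma sum_inv_le_root (M : nat) (s : R) : 0 <= s -> M%:R <= s ^+ 4 ->
  \sum_(2 <= r < M.+1) r%:R^-1 <= 4 * s :> R.
Proof.
suff H (n : nat) : \sum_(2 <= r < n.+1) r%:R^-1 <= 4 * Num.sqrt (Num.sqrt n%:R) :> R.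
  move=> s0 Ms; apply: (le_trans (H M)); rewrite ler_pM2l//.
  rewrite -(ler_pXn2r (n := 4)) ?nnegrE ?sqrtr_ge0//.
  by rewrite [leLHS](exprM _ 2 2) !sqr_sqrtr.
clear s; elim: n => [|n IH]; first by rewrite big_geq// mulr_ge0.
case: n IH => [|n] IH; first by rewrite big_geq// mulr_ge0.
rewrite big_nat_recr//=; apply: (le_trans (lerD IH (lexx _))).
set t := Num.sqrt (Num.sqrt n.+2%:R); set s := Num.sqrt (Num.sqrt n.+1%:R).
have s4 : s ^+ 4 = n.+1%:R by rewrite (exprM _ 2 2) !sqr_sqrtr.
have t4 : t ^+ 4 = n.+2%:R by rewrite (exprM _ 2 2) !sqr_sqrtr.
have s0 : 0 <= s by exact: sqrtr_ge0.
have t0 : 1 <= t.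
  by rewrite /t -[leLHS]sqrtr1 ler_wsqrtr// -[leLHS]sqrtr1 ler_wsqrtr// ler1n.
have st : s <= t by rewrite !ler_wsqrtr// ler_nat.
rewrite -lerBrDl -mulrBr -t4.
have d : t ^+ 4 - s ^+ 4 = 1 by rewrite s4 t4 -natrB// subSnn.
have tp : 0 < t by lra.
rewrite -[leLHS]div1r ler_pdivrMr ?exprn_gt0// -[leLHS]d.
have -> : t ^+ 4 - s ^+ 4 = (t - s) * ((t + s) * (t ^+ 2 + s ^+ 2)) by ring.
rewrite [4 * _]mulrC -mulrA ler_wpM2l ?subr_ge0//.
have h1 : (t + s) * (t ^+ 2 + s ^+ 2) <= (2 * t) * (2 * t ^+ 2).
  apply: ler_pM; rewrite ?addr_ge0 ?exprn_ge0 ?(ltW tp)//; first lra.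
  have : s ^+ 2 <= t ^+ 2 by rewrite !expr2 ler_pM.
  lra.
apply: (le_trans h1).
have -> : (2 * t) * (2 * t ^+ 2) = 4 * t ^+ 3 by ring.
by rewrite ler_pM2l//; apply: ler_weXn2l.
Qed.
End numeric_sums.

Section selection.
Context {R : realType} (xi : R) (xi_irr : irrational xi).

Local Notation p k := (numq (convergent xi k)).
Local Notation q := (convergent_denn xi).
Let q_gt0 := convergent_denn_gt0 xi.
Let q_ge := convergent_denn_ge xi_irr.
Let q_le := convergent_denn_mono xi_irr.
Let pq_coprime := convergent_denn_coprime xi.
Let approx := convergent_denn_approx xi_irr.

(** The two fractions play different roles: $a/b$ splits the plane into the
    lines on which coprime points are counted, and $c/e$ keeps the values
    $q \xi + p$ with $|q| < e/2$ apart.  The count needs $e$ larger than $b$ by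
    a power of $b$, while the values on one line must stay within $\epsilon$
    of each other.  With $a/b$ the $i$-th convergent, let $q_k$ be the first
    denominator with $q_k^3 \ge q_i^4$.  The only obstruction to the choice
    $e = q_k$ is $q_k$ being of size $q_i^2$ or more with $k > i + 1$; then the
    jump takes place after $q_{k-1} < q_i^{4/3}$, and the convergents of index
    $k - 1$ and $k$ do. *)
Lemma two_scales (eps : R) (B : nat) : 0 < eps ->
  exists (a c : int) (b e : nat),
    [/\ coprimez a b, coprimez c e & (0 < b)%N] /\
    [/\ (B <= b)%N, (b ^ 4 <= e ^ 3)%N,
        `|xi - a%:~R / b%:R| * e%:R <= eps &
        `|xi - c%:~R / e%:R| <= (e%:R ^+ 2)^-1].
Proof.
move=> eps0; pose D := (Num.truncn eps^-1).+1.
have DE : (D%:R : R)^-1 <= eps.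
  rewrite -[leRHS]invrK lef_pV2 ?posrE ?invr_gt0 ?ltr0n//.
  by rewrite ltW// truncnS_gt// invr_ge0 ltW.
pose i := (B + D ^ 5)%N.
have D0 : (0 < D)%N by [].
have iD : (D ^ 5 <= q i)%N by rewrite (leq_trans _ (q_ge i))// leq_addl.
have iB : (B <= q i)%N by rewrite (leq_trans _ (q_ge i))// leq_addr.
have self k : `|xi - (p k)%:~R / (q k)%:R| <= ((q k)%:R ^+ 2)^-1.
  apply: (le_trans (approx k)).
  rewrite expr2 lef_pV2 ?posrE ?mulr_gt0 ?ltr0n ?q_gt0//.
  by rewrite ler_pM2l ?ltr0n ?q_gt0// ler_nat q_le.
have DD5 : (D <= D ^ 5)%N by rewrite -{1}[D]expn1 leq_pexp2l.
(* Here e |xi - a/b| <= 1/b, so only the size of e matters. *)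
have consecutive j : (i <= j)%N -> (q j ^ 4 <= q j.+1 ^ 3)%N ->
    exists (a c : int) (b e : nat),
    [/\ coprimez a b, coprimez c e & (0 < b)%N] /\
    [/\ (B <= b)%N, (b ^ 4 <= e ^ 3)%N,
        `|xi - a%:~R / b%:R| * e%:R <= eps &
        `|xi - c%:~R / e%:R| <= (e%:R ^+ 2)^-1].
  move=> ij jj; exists (p j), (p j.+1), (q j), (q j.+1); split; first by split.
  split=> //; first exact: leq_trans iB (q_le ij).
  apply: (le_trans _ DE).
  apply: (@le_trans _ _ (((q j)%:R * (q j.+1)%:R)^-1 * (q j.+1)%:R)).
    by rewrite ler_wpM2r// (approx j).
  rewrite invfM -mulrA mulVf ?mulr1 ?pnatr_eq0 -?lt0n ?q_gt0//.
  rewrite lef_pV2 ?posrE ?ltr0n ?q_gt0// ler_nat.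
  by rewrite (leq_trans DD5)// (leq_trans iD)// q_le.
have exk : exists k, (i < k)%N && (q i ^ 4 <= q k ^ 3)%N.
  exists (i + q i ^ 4).+1%N; rewrite ltnS leq_addr /=.
  apply: (@leq_trans (q (i + q i ^ 4).+1)); last first.
    by rewrite -{1}[q _]expn1 leq_pexp2l.
  by rewrite (leq_trans _ (q_ge _))// leqW// leq_addl.
case: (ex_minnP exk) => k /andP[ik qk] kmin.
case: k ik qk kmin => // l il ql lmin.
have [il'|li] := ltnP i l; last first.
  have ll : l = i by apply/eqP; rewrite eqn_leq li -ltnS.
  by apply: (consecutive i) => //; rewrite -ll in ql *.
have ql' : (q l ^ 3 < q i ^ 4)%N.
  rewrite ltnNge; apply/negP => h.
  by have := lmin l; rewrite il' h /= ltnn => /(_ isT).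
have [Dq|Dq] := leqP (D * q l.+1) (q i ^ 2).
  exists (p i), (p l.+1), (q i), (q l.+1); split; first by split.
  split=> //; apply: (le_trans _ DE).
  apply: (@le_trans _ _ (((q i)%:R * (q i.+1)%:R)^-1 * (q l.+1)%:R)).
    by rewrite ler_wpM2r// (approx i).
  rewrite ler_pdivrMl ?mulr_gt0 ?ltr0n ?q_gt0// ler_pdivlMr ?ltr0n//.
  rewrite -!natrM ler_nat mulnC (leq_trans Dq)//.
  by rewrite expnS expn1 leq_mul2l q_le ?orbT.
apply: (consecutive l); first exact: ltnW.
rewrite -(@leq_exp2r _ _ 3)// -!expnM.
rewrite -(@leq_pmul2r (D ^ 9)) ?expn_gt0//.
have h1 : (q l ^ 12 <= q i ^ 16)%N.
  by rewrite (expnM _ 3 4) (expnM _ 4 4) leq_exp2r// ltnW.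
have h2 : (q i ^ 18 <= q l.+1 ^ 9 * D ^ 9)%N.
  by rewrite (expnM _ 2 9) -expnMn leq_exp2r// mulnC ltnW.
apply: (leq_trans _ h2); rewrite (expnD _ 16 2) leq_mul//.
have : ((D ^ 5) ^ 2 <= q i ^ 2)%N by rewrite leq_exp2r.
by apply: leq_trans; rewrite -expnM leq_pexp2l.
Qed.

End selection.

Lemma natr_divn_le (R : realFieldType) (m d : nat) :
  (0 < d)%N -> (m %/ d)%:R <= m%:R / d%:R :> R.
Proof.
by move=> d0; rewrite ler_pdivlMr ?ltr0n// -natrM ler_nat leq_divM.
Qed.

Lemma natr_divn_ge (R : realFieldType) (m d : nat) :
  (0 < d)%N -> m%:R / d%:R - 1 <= (m %/ d)%:R :> R.
Proof.
move=> d0; rewrite lerBlDr natr1 ler_pdivrMr ?ltr0n// -natrM ler_nat.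
by rewrite ltnW// ltn_ceil.
Qed.

(** There are about $K x$ points in all, and about $K x / r^2$ of them are
    multiples of $r$.  Since $\sum_{r \ge 2} r^{-2} \le 3/4$, discarding them
    for each $r \ge 2$ leaves a positive proportion, provided that the rounding
    errors, $(K + x) / r + 1$ for each $r \le M$, are of smaller order. *)
Lemma positive_proportion (R : rcfType) (K N b M G : nat) (s : R) :
  let x := N%:R / b%:R in
  (0 < b)%N -> 0 <= s -> M%:R <= s ^+ 4 ->
  (K * (N %/ b) <=
     G + \sum_(2 <= r < M.+1) (K %/ r + 1) * (N %/ (r * b) + 1))%N ->
  32 <= x -> 128 * s <= x -> 128 * s <= K%:R -> 32 * M%:R <= K%:R * x ->
  K%:R * x / 8 <= G%:R.
Proof.
move=> x b0 s0 Ms count x32 xs Ks MKx.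
have K0 : 0 <= K%:R :> R by [].
have x0 : 0 <= x by lra.
have tail : (\sum_(2 <= r < M.+1) (K %/ r + 1) * (N %/ (r * b) + 1))%:R <=
    K%:R * x * (3 / 4) + (K%:R + x) * (4 * s) + M%:R.
  apply: (@le_trans _ _ (\sum_(2 <= r < M.+1)
      (K%:R * x * r%:R^-1 ^+ 2 + (K%:R + x) * r%:R^-1 + 1))).
    rewrite natr_sum !big_nat; apply: ler_sum => r /andP[r2 _].
    have r0 : (0 < r)%N by lia.
    have r0' : r%:R != 0 :> R by rewrite pnatr_eq0 -lt0n.
    have b0' : b%:R != 0 :> R by rewrite pnatr_eq0 -lt0n.
    have -> : K%:R * x * r%:R^-1 ^+ 2 + (K%:R + x) * r%:R^-1 + 1 =
        (K%:R / r%:R + 1) * (N%:R / (r * b)%:R + 1) :> R.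
      by rewrite /x natrM; field; rewrite r0' b0'.
    rewrite natrM !natrD ler_pM//.
      by rewrite lerD2r natr_divn_le.
    by rewrite lerD2r natr_divn_le// muln_gt0 r0.
  rewrite !big_split /= -!mulr_sumr !lerD//.
  - by rewrite ler_wpM2l ?sum_inv_sqr_le// mulr_ge0.
  - by rewrite ler_wpM2l ?sum_inv_le_root// addr_ge0.
  - by rewrite sumr_const_nat ler_nat; lia.
have main : K%:R * (x - 1) <=
    G%:R + (K%:R * x * (3 / 4) + (K%:R + x) * (4 * s) + M%:R).
  apply: (@le_trans _ _ ((K * (N %/ b))%:R)).
    by rewrite natrM ler_wpM2l// natr_divn_ge.
  by apply: le_trans (lerD (lexx _) tail); rewrite -natrD ler_nat.
have h1 : K%:R * 32 <= K%:R * x by rewrite ler_wpM2l.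
have h2 : K%:R * (128 * s) <= K%:R * x by rewrite ler_wpM2l.
have h3 : x * (128 * s) <= x * K%:R by rewrite ler_wpM2l.
lra.
Qed.

Section primitive_points.
Context {R : realType} (xi : R) (xi_irr : irrational xi).

Definition form (pq : int * int) : R := pq.2%:~R * xi + pq.1%:~R.

(** Below $e/2$ the values of $q \xi + p$ behave like those of $q c / e + p$,
    which are multiples of $1/e$. *)
Lemma form_separated (c : int) (e : nat) (w w' : int * int) :
  (0 < e)%N -> coprimez c e ->
  `|xi - c%:~R / e%:R| <= (e%:R ^+ 2)^-1 -> w != w' ->
  `|w.2 - w'.2| *+ 2 <= e%:Z ->
  (2 * e%:R)^-1 <= `|form w - form w'|.
Proof.
move=> e0 ce approx ww' q2.
pose t := w.2 - w'.2; pose d := w.1 - w'.1.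
have -> : form w - form w' =
    t%:~R * (xi - c%:~R / e%:R) + (t * c + d * e)%:~R / e%:R.
  rewrite /form /t /d !rmorphD !rmorphM /= !rmorphN /=.
  by field; rewrite pnatr_eq0 -lt0n.
have E0 : 0 < e%:R :> R by rewrite ltr0n.
have nz : t * c + d * e != 0.
  apply/negP => /eqP h.
  have et : (e %| t)%Z.
    rewrite -(@Gauss_dvdzl _ _ c) 1?coprimez_sym//.
    by apply/dvdzP; exists (- d); lia.
  have t0 : t = 0.
    move: et q2; rewrite -/t => /dvdzP[z ->]; rewrite normrM.
    case: (eqVneq z 0) => [->|z0]; first by rewrite mul0r.
    have : 1 <= `|z| by rewrite -gtz0_ge1 normr_gt0.
    by move=> z1; rewrite -mulr_natl => h'; nia.
  have d0 : d = 0 by move: h; rewrite t0 mul0r add0r => /eqP; rewrite mulf_eq0 => /orP[/eqP//|]; lia.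
  move/eqP: ww'; apply.
  rewrite [w]surjective_pairing [w']surjective_pairing.
  by congr (_, _); apply/eqP; rewrite -subr_eq0 -/d -/t ?d0 ?t0.
have big : e%:R^-1 <= `|(t * c + d * e)%:~R / e%:R| :> R.
  rewrite normrM normfV [`|e%:R|]gtr0_norm// -[leLHS]mul1r ler_pM2r ?invr_gt0//.
  by rewrite -intr_norm ler1z -gtz0_ge1 normr_gt0.
have small : `|t%:~R * (xi - c%:~R / e%:R)| <= (2 * e%:R)^-1 :> R.
  rewrite normrM; apply: (@le_trans _ _ (e%:R / 2 * (e%:R ^+ 2)^-1)).
    apply: ler_pM => //; rewrite ler_pdivlMr// -intr_norm.
    have : `|t| * 2 <= e%:Z by move: q2; rewrite -/t; lia.
    by rewrite -(ler_int R) intrM -!pmulrn.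
  by rewrite le_eqVlt; apply/orP; left; apply/eqP; field; rewrite gt_eqF.
have -> : (2 * e%:R)^-1 = e%:R^-1 - (2 * e%:R)^-1 :> R by field; rewrite gt_eqF.
apply: le_trans (lerB big small) _.
by rewrite [X in _ <= `|X|]addrC; exact: lerB_normD.
Qed.
(** Size conditions of [positive_proportion], for $K \approx b \ell / 2$ lines
    carrying $N \approx e / 2$ points spread over the classes mod $b = s^4$. *)
Lemma scale_arithmetic (Y l C s b e K x M : R) :
  0 < l -> 1 <= Y -> C = 384 * Y * (1 + l^-1) ->
  s ^+ 4 = b -> C <= s -> C * (s * b) <= e -> b * l / 2 < K + 1 ->
  e / 3 / b <= x -> M <= Y * b ->
  [/\ 32 <= x, 128 * (Y * s) <= x, 128 * (Y * s) <= K, 32 * M <= K * x &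
      [/\ M <= (Y * s) ^+ 4, (4 * e)^-1 <= l / 8 & (l * e / 96 <= K * x / 8)]].
Proof.
move=> l0 Y1 CE' s4 sC eb K2 xN M1.
have li0 : 0 < l^-1 by rewrite invr_gt0.
have Y0 : 0 <= Y by lra.
have Yl : l^-1 <= Y * l^-1 by rewrite ler_peMl// ltW.
have CE : C = 384 * Y + 384 * (Y * l^-1) by rewrite CE'; ring.
have C1 : 1 <= C by lra.
have s1 : 1 <= s by exact: le_trans sC.
have s0 : 0 <= s by lra.
have b1 : s <= b by rewrite -s4 -[leLHS]expr1 ler_weXn2l.
have b0 : 0 < b by lra.
have eC : C <= e.
  apply: le_trans eb; rewrite ler_peMr//; first by lra.
  by rewrite -[leLHS]mul1r ler_pM// (le_trans s1).
have e0 : 0 < e by lra.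
have xC : 128 * (Y * s) + 128 * (Y * l^-1 * s) <= x.
  apply: le_trans xN; rewrite ler_pdivlMr// ler_pdivlMr//.
  by apply: le_trans eb; rewrite CE; lra.
have Ys : s <= Y * s by rewrite ler_peMl.
have Yls : Y * l^-1 <= Y * l^-1 * s by rewrite ler_peMr// mulr_ge0// ltW.
have Yls0 : 0 < Y * l^-1 by lra.
have bl4 : 4 <= b * l.
  rewrite -ler_pdivrMr//; apply: le_trans b1; apply: le_trans sC.
  clear -Yl CE Y1 li0; lra.
have K4 : b * l / 4 <= K by clear -bl4 K2; lra.
have xY : 128 * (Y * l^-1) <= x by clear -xC Yls Ys s0; lra.
have x32 : 32 <= x by clear -xC Yls Ys s1 Yls0; lra.
split=> //.
- by clear -xC Yls Yls0; lra.
- apply: le_trans K4; rewrite -s4 ler_pdivlMr//.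
  have h : 384 * Y <= s * l.
    by rewrite -ler_pdivrMr//; apply: le_trans sC; clear -CE Y0; lra.
  have h' : 384 * Y * s <= s * l * s by rewrite ler_wpM2r.
  have -> : s ^+ 4 * l = s * l * s * s ^+ 2 by ring.
  have h2 : 2 <= s ^+ 2.
    have : 384 * s <= s * s by rewrite ler_wpM2r//; clear -CE Y1 sC Yls0; lra.
    by rewrite expr2; move: s1; clear; lra.
  have h3 : s * l * s * 2 <= s * l * s * s ^+ 2.
    by rewrite ler_wpM2l// !mulr_ge0// ltW.
  by clear -h' h3 Ys s0; lra.
- apply: (@le_trans _ _ (b * l / 4 * (128 * (Y * l^-1)))).
    have -> : b * l / 4 * (128 * (Y * l^-1)) = 32 * (Y * b).
      by field; rewrite gt_eqF.
    by rewrite ler_pM2l.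
  by apply: ler_pM => //; rewrite !mulr_ge0// ltW.
- split.
  + apply: (le_trans M1); rewrite exprMn s4 ler_pM2r//.
    by rewrite -[leLHS]expr1 ler_weXn2l.
  + rewrite -[leRHS]invrK lef_pV2 ?posrE ?invr_gt0 ?mulr_gt0//.
    by rewrite invfM invrK; clear -eC CE Y1 Yl li0; lra.
  + apply: (@le_trans _ _ (b * l / 4 * (e / 3 / b) / 8)).
      by rewrite le_eqVlt; apply/orP; left; apply/eqP; field; rewrite gt_eqF.
    rewrite ler_pM2r//; apply: ler_pM => //; first by rewrite !mulr_ge0// ltW.
    by rewrite !mulr_ge0 ?invr_ge0// ltW.
Qed.

(** If $m = q a + p b$ then $q \xi + p = m / b + q (\xi - a / b)$, where the last
    term is small for $q \le e$.  So the points are taken on the lines for which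
    $m / b$ lies in the middle half of the interval; as the interval avoids 0,
    these $m$ are not 0 and are at most $M = Y b$ in absolute value. *)
Lemma many_primitive_points (u v : R) (T : nat) :
  u < v -> (0 < u) || (v < 0) ->
  exists (e : nat) (F : seq (int * int)), [/\ uniq F, (0 < e)%N,
    (v - u) * e%:R / 96 <= (size F)%:R,
    {in F, forall w, [/\ primitive_point w, T%:Z <= w.2, w.2 <= e%:Z &
      u + (4 * e%:R)^-1 <= form w <= v - (4 * e%:R)^-1]} &
    {in F &, forall w w', w != w' -> (2 * e%:R)^-1 <= `|form w - form w'|}].
Proof.
move=> uv uv0; pose l := v - u; pose Y := 1 + `|u| + `|v|.
have l0 : 0 < l by rewrite subr_gt0.
have Y1 : 1 <= Y by rewrite /Y -addrA lerDl addr_ge0.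
pose C := 384 * Y * (1 + l^-1).
have C1 : 1 <= C.
  rewrite /C -[leLHS]mul1r ler_pM//; first by lra.
  by rewrite lerDl invr_ge0 ltW.
have C0 : 0 <= C by exact: le_trans C1.
have Y0 : 0 <= Y by exact: le_trans Y1.
have CE : C = 384 * Y * (1 + l^-1) by [].
clearbody C.
have l8 : 0 < l / 8 by lra.
have [a [c [b [e [[ab ce b0] [Bb be dab dce]]]]]] :=
  two_scales xi_irr ((Num.truncn (C ^+ 12)).+1 + 2 * T + 2) l8.
have bT : (2 * T + 2 <= b)%N by rewrite (leq_trans _ Bb)// -addnA leq_addl.
have bR0 : 0 < b%:R :> R by rewrite ltr0n.
pose s : R := Num.sqrt (Num.sqrt b%:R).
have s0 : 0 <= s by exact: sqrtr_ge0.
have s4 : s ^+ 4 = b%:R by rewrite (exprM _ 2 2) !sqr_sqrtr.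
clearbody s.
have sC3 : C ^+ 3 <= s.
  rewrite -(ler_pXn2r (n := 4)) ?nnegrE ?exprn_ge0//.
  rewrite s4 -exprM; apply: (@le_trans _ _ (Num.truncn (C ^+ 12)).+1%:R).
    by rewrite ltW// truncnS_gt.
  by rewrite ler_nat (leq_trans _ Bb)// -addnA leq_addr.
have sC : C <= s by apply: le_trans sC3; rewrite -[leLHS]expr1 ler_weXn2l.
have s1 : 1 <= s by exact: le_trans sC.
have eb : C * (s * b%:R) <= e%:R.
  have Csb : 0 <= C * (s * b%:R) by apply: mulr_ge0 => //; apply: mulr_ge0.
  rewrite -(ler_pXn2r (n := 3)) ?nnegrE//.
  apply: (@le_trans _ _ (b%:R ^+ 4)); last by rewrite -!natrX ler_nat.
  rewrite -s4 -exprM.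
  have -> : (C * (s * s ^+ 4)) ^+ 3 = C ^+ 3 * s ^+ 15 by ring.
  by rewrite (exprS s 15) ler_wpM2r// exprn_ge0.
have be' : (b <= e)%N.
  rewrite -(leq_exp2r _ _ (_ : 0 < 3)%N)//; apply: leq_trans be.
  by rewrite leq_pexp2l.
have e0 : (0 < e)%N by exact: leq_trans be'.
pose N := e./2.
have N0 : (0 < N)%N by clear -bT be'; rewrite /N; lia.
have NT : (T <= N)%N by clear -bT be'; rewrite /N; lia.
have Ne : (2 * N <= e)%N by clear -bT be'; rewrite /N; lia.
have N3 : e%:R / 3 <= N%:R :> R.
  by rewrite ler_pdivrMr// -natrM ler_nat; clear -bT be'; rewrite /N; lia.
pose x : R := N%:R / b%:R.
pose K := Num.truncn (b%:R * l / 2).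
have bl0 : 0 <= b%:R * l / 2 by rewrite !mulr_ge0// ltW.
have [K1 K2] : K%:R <= b%:R * l / 2 /\ b%:R * l / 2 < K%:R + 1.
  by have /andP[h1 h2] := truncn_itv bl0; split=> //; rewrite natr1.
pose M := Num.truncn (Y * b%:R).
have M1 : M%:R <= Y * b%:R by rewrite truncn_le mulr_ge0.
have xN : e%:R / 3 / b%:R <= x by rewrite /x ler_pM2r// invr_gt0.
have [x32 xYs KYs MKx [MYs e8 sizeF]] :=
  scale_arithmetic l0 Y1 CE s4 sC eb K2 xN M1.
(* The first m with m / b beyond the first quarter of the interval. *)
pose m0 : int := Num.floor (b%:R * (u + l / 4)) + 1.
have m0E : b%:R * (u + l / 4) < m0%:~R <= b%:R * (u + l / 4) + 1.
  by rewrite /m0 floorD1_gt /= intrD lerD2r floor_le.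
have m_in (i : 'I_K) :
    b%:R * (u + l / 4) <= (m0 + i%:Z)%:~R <= b%:R * (v - l / 4).
  have iK : i%:R + 1 <= K%:R :> R by rewrite natr1 ler_nat.
  rewrite intrD -pmulrn; have /andP[h1 h2] := m0E; have i0 : 0 <= i%:R :> R by [].
  have -> : b%:R * (v - l / 4) = b%:R * (u + l / 4) + b%:R * l / 2.
    by rewrite /l; field.
  by clear -h1 h2 iK i0 K1; apply/andP; split; lra.
have m_bound (i : 'I_K) : (0 < `|(m0 + i%:Z)%R| <= M)%N.
  have /andP[h1 h2] := m_in i; apply/andP; split.
    rewrite absz_gt0 -(intr_eq0 R); case/orP: uv0 => h.
      rewrite gt_eqF//; apply: lt_le_trans h1; rewrite mulr_gt0//; lra.
    rewrite lt_eqF//; apply: (le_lt_trans h2); rewrite pmulr_rlt0//; lra.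
  rewrite /M truncn_ge_nat; last by rewrite mulr_ge0.
  rewrite pmulrn abszE intr_norm ler_norml mulrC.
  have := ler_norm u; have := ler_norm v; have := ler_norm (- u); have := ler_norm (- v).
  rewrite !normrN => n1 n2 n3 n4.
  apply/andP; split.
    by apply: le_trans h1; rewrite -mulrN ler_pM2l// /Y; lra.
  by apply: (le_trans h2); rewrite ler_pM2l// /Y; lra.
pose P := line_primitive a m0 b N K.
have count : K%:R * x / 8 <= #|P|%:R.
  have Ys0 : 0 <= Y * s by exact: mulr_ge0.
  exact: (positive_proportion b0 Ys0 MYs (card_line_primitive b0 N0 ab m_bound)).
pose f (ij : 'I_K * 'I_N) := (line_p a m0 b ij.1 ij.2, line_q ij.2).
have f_inj : {in P &, injective f}.
  move=> [i j] [i' j']; rewrite !inE /= => /andP[h _] /andP[h' _] [].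
  move=> pp qq.
  have jj : j = j' by apply: val_inj; move: qq; clear; rewrite /line_q /=; lia.
  subst j'; congr (_, _); apply: val_inj => /=.
  have := @line_pE a m0 b N K i j; have := @line_pE a m0 b N K i' j.
  by rewrite !inE /= h h' pp => /(_ isT) -> /(_ isT); clear; lia.
exists e, [seq f ij | ij <- enum P]; split => //.
- by rewrite map_inj_in_uniq ?enum_uniq// => ? ?; rewrite !mem_enum; exact: f_inj.
- by rewrite size_map -cardE; exact: le_trans count.
- move=> _ /mapP[[i j] ijP ->]; rewrite mem_enum in ijP.
  have := ijP; rewrite !inE => /andP[/= ijS cop]; rewrite /f /=.
  have jN := ltn_ord j.
  have qe : line_q j <= e%:Z by clear -jN Ne; rewrite /line_q; lia.
  have q0 : 0 <= line_q j by clear; rewrite /line_q; lia.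
  split => //; first by clear -NT; rewrite /line_q; lia.
  have pE : (line_p a m0 b i j)%:~R * b%:R =
      (m0 + i%:Z)%:~R - (line_q j)%:~R * a%:~R :> R.
    have ijL : (i, j) \in line_points a m0 b N K by rewrite inE.
    by rewrite -intrM -intrB -(line_pE ijL) intrM -pmulrn.
  have -> : form (line_p a m0 b i j, line_q j) =
      (m0 + i%:Z)%:~R / b%:R + (line_q j)%:~R * (xi - a%:~R / b%:R).
    have bn : b%:R != 0 :> R by rewrite gt_eqF.
    rewrite /form /= -[X in _ + X = _](mulfK bn) pE.
    by field.
  have : `|(line_q j)%:~R * (xi - a%:~R / b%:R)| <= l / 8.
    apply: le_trans dab; rewrite normrM mulrC ler_wpM2l// -intr_norm ger0_norm//.
    by rewrite [leRHS]pmulrn ler_int.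
  rewrite ler_norml => /andP[d1 d2].
  have /andP[h1 h2] := m_in i.
  have {}h1 : u + l / 4 <= (m0 + i%:Z)%:~R / b%:R by rewrite ler_pdivlMr// mulrC.
  have {}h2 : (m0 + i%:Z)%:~R / b%:R <= v - l / 4 by rewrite ler_pdivrMr// mulrC.
  have vE : v = u + l by rewrite /l addrC subrK.
  by clear -d1 d2 h1 h2 e8 vE; apply/andP; split; lra.
- move=> _ _ /mapP[[i j] _ ->] /mapP[[i' j'] _ ->] ww'.
  apply: (form_separated e0 ce dce ww'); rewrite /f /= /line_q.
  by have := ltn_ord j; have := ltn_ord j'; clear -Ne; lia.
Qed.

End primitive_points.

Local Open Scope classical_set_scope.

(** * From a positive proportion in every interval to almost everywhere *)

(** At almost every point of [Z] the density of [Z] is 1, whereas the hypothesis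
    bounds it by [c] everywhere except at 0. *)
Lemma ae_notin_of_density_lt1 (R : realType) (Z : set R) (c : R) :
  measurable Z -> c < 1 ->
  (forall x r : R, 0 < r -> r < `|x| ->
     (lebesgue_measure (Z `&` ball x r) <= (c * (r *+ 2))%:E)%E) ->
  {ae @lebesgue_measure R, forall x, ~ Z x}.
Proof.
move=> mZ c1 Zc.
have z0 : {ae @lebesgue_measure R, forall x : R, x != 0}.
  exists [set 0]; split; [exact: measurable_set1|exact: lebesgue_measure_set1|].
  by move=> x /= /negP; rewrite negbK => /eqP.
apply: (@filterS2 _ _ (ae_filter_ringOfSetsType (@lebesgue_measure R))
  _ _ _ _ z0 (lebesgue_density mZ)) => x x0 + Zx.
rewrite indicE mem_set//= => lim1.
have : (1%:E <= c%:E :> \bar R)%E.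
  apply: (cvge_to_le lim1); near=> r.
  have r0 : 0 < r by [].
  rewrite [X in (_ * X^-1)%E](lebesgue_measure_ball _ (ltW r0)) inver.
  rewrite gt_eqF ?pmulrn_lgt0//=.
  rewrite lee_pdivrMr ?pmulrn_lgt0// -EFinM; apply: Zc => //.
  near: r; apply: nbhs_right_lt; by rewrite normr_gt0.
by rewrite lee_fin leNgt c1.
Unshelve. all: by end_near. Qed.

Definition approximable (R : realType) (xi : R) (T : nat) : set R :=
  \bigcup_(w in [set w : int * int | primitive_point w /\ T%:Z < w.2])
    `[form xi w - 2 / w.2%:~R, form xi w + 2 / w.2%:~R].

Lemma measurable_approximable (R : realType) (xi : R) (T : nat) :
  measurable (approximable xi T).
Proof.
rewrite /approximable bigcup_mkcond; apply: countable_bigcupT_measurable.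
  exact: countableP.
by move=> w; case: ifP => // _; exact: measurable_itv.
Qed.

(** Finitely many solutions would bound $q$. *)
Lemma approximable_infinite (R : realType) (xi y : R) :
  (forall T, approximable xi T y) ->
  infinite_set [set pq : int * int |
    [/\ primitive_point pq, pq.2 != 0
      & `|pq.2%:~R * xi + pq.1%:~R - y| <= 2 / `|pq.2%:~R| ]].
Proof.
move=> Ey /finite_seqP[F FE].
have [w [wp wT] wy] := Ey (\max_(w <- F) `|w.2|)%N.
have w0 : 0 < w.2 by apply: le_lt_trans wT.
suff wF : w \in F.
  have := @leq_bigmax_seq _ F predT (fun w : int * int => `|w.2|%N) w wF isT.
  by rewrite leqNgt -ltz_nat gtz0_abs// wT.
have : [set` F] w; last by [].
rewrite -FE /=; split=> //; first by rewrite gt_eqF.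
rewrite [`|w.2%:~R|]gtr0_norm ?ltr0z// distrC ler_distl.
by move: wy; rewrite /= in_itv.
Qed.

(** The intervals of radius $1 / (4 e)$ around the values of the points of
    [many_primitive_points] are disjoint, contained in $(u, v)$, and narrower than
    $2 / q$ since $q \le e$. *)
Lemma measure_approximable (R : realType) (xi : R) (T : nat) (u v : R) :
  irrational xi -> u < v -> (0 < u) || (v < 0) ->
  (((v - u) / 192)%:E <= lebesgue_measure (approximable xi T `&` `]u, v[))%E.
Proof.
move=> xi_irr uv uv0.
have [e [F [Fu e0 sizeF F1 F2]]] := many_primitive_points xi_irr T.+1 uv uv0.
have E0 : 0 < e%:R :> R by rewrite ltr0n.
pose d : R := (4 * e%:R)^-1.
have d0 : 0 < d by rewrite invr_gt0 mulr_gt0.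
pose J (w : int * int) : set R := `]form xi w - d, form xi w + d[.
have mJ w : measurable (J w) by exact: measurable_itv.
have muJ w : lebesgue_measure (J w) = (d + d)%:E.
  rewrite lebesgue_measure_itv/= lte_fin ltrD2l gt0_cp// -EFinB.
  by congr EFin; ring.
have trivJ : trivIset [set` F] J.
  move=> w w' /= wF w'F [z []]; rewrite /J /= !in_itv /= => /andP[a1 a2] /andP[b1 b2].
  apply: contrapT => /eqP ww'; have := F2 _ _ wF w'F ww'.
  have -> : (2 * e%:R)^-1 = d + d by rewrite /d; field; rewrite gt_eqF.
  by rewrite leNgt ltr_norml => /negP; apply; apply/andP; split; lra.
apply: (@le_trans _ _ (lebesgue_measure (\bigcup_(w in [set` F]) J w))).
  rewrite measure_fin_bigcup; [|exact: finite_seq|exact: trivJ|by move=> w _; exact: mJ].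
  rewrite -(fsbig_seq _ _ Fu) /=.
  rewrite (eq_bigr (fun=> (d + d)%:E)); last by move=> w _; exact: muJ.
  rewrite sumEFin lee_fin big_const_seq count_predT iter_addr_0.
  have -> : (v - u) / 192 = (d + d) * ((v - u) * e%:R / 96).
    by rewrite /d; field; rewrite gt_eqF.
  by rewrite -[leRHS]mulr_natr ler_pM2l// addr_gt0.
apply: le_measure; rewrite ?inE.
- by apply: fin_bigcup_measurable (finite_seq F) (fun w _ => mJ w).
- by apply: measurableI; [exact: measurable_approximable|exact: measurable_itv].
move=> z [w /= wF]; rewrite /J /= in_itv /= => /andP[z1 z2].
have [wp wT we /andP[w1 w2]] := F1 _ wF.
have q0 : 0 < w.2%:~R :> R by rewrite ltr0z (lt_le_trans _ wT).
have dq : d <= 2 / w.2%:~R.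
  have : w.2%:~R <= e%:R :> R by rewrite [leRHS]pmulrn ler_int.
  move=> h; rewrite ler_pdivlMr// mulrC ler_pdivrMr ?mulr_gt0//; lra.
rewrite -/d in w1 w2; split.
  exists w => /=; first by split.
  by rewrite in_itv /=; apply/andP; split; lra.
by rewrite /= in_itv /=; apply/andP; split; lra.
Qed.

Lemma ae_approximable (R : realType) (xi : R) (T : nat) : irrational xi ->
  {ae @lebesgue_measure R, forall y, approximable xi T y}.
Proof.
move=> xi_irr.
have mE := measurable_approximable xi T.
have c1 : 1 - 192^-1 < 1 :> R by lra.
have := ae_notin_of_density_lt1 (measurableC mE) c1 _.
move=> H; apply: (@filterS _ _ (ae_filter_ringOfSetsType (@lebesgue_measure R))
  _ _ _ (H _)) => [y /contrapT//|x r r0 rx].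
rewrite setIC -setDE measureD//=.
- rewrite (@lebesgue_measure_ball _ x r (ltW r0)).
  have := measure_approximable T xi_irr (u := x - r) (v := x + r).
  rewrite -ball_itv setIC.
  have -> : x + r - (x - r) = r *+ 2 by rewrite mulr2n; ring.
  have rr : x - r < x + r by lra.
  have xr : (0 < x - r) || (x + r < 0).
    by move: rx; rewrite lter_normr => /orP[h|h]; apply/orP; [left|right]; lra.
  move=> /(_ rr xr) low; apply: (le_trans (leeB (lexx _) low)).
  by rewrite -EFinB lee_fin mulrBl mul1r mulrC.
- by rewrite ball_itv; exact: measurable_itv.
- by rewrite (@lebesgue_measure_ball _ x r (ltW r0)) ltry.
Qed.

(** * Slow growth of the denominators for almost every number *)

(** The ratio $(j + 2)^2$ of consecutive scales makes the exceptional sets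
    summable, while the scales grow slowly enough for $\sum_j 1 / \log$ [scale j]
    to diverge. *)
Definition scale (j : nat) : nat := (j.+1)`! ^ 2.

Lemma scaleS (j : nat) : scale j.+1 = (j.+2 ^ 2 * scale j)%N.
Proof. by rewrite /scale factS expnMn. Qed.

Lemma scale_gt0 (j : nat) : (0 < scale j)%N.
Proof. by rewrite expn_gt0 fact_gt0. Qed.

Section gap_sets.
Context {R : realType}.

(** [gap_set] is made of neighbourhoods of the fractions $p / q$ with
    $q = i + 1 \le$ [scale j] and $p = t - (n + 1) q$, $|p| \le (n + 1) q$.  It
    contains every number of $[-n, n]$ whose denominators jump over the range
    between two consecutive scales. *)
Definition gap_itv (n j i t : nat) : set R :=
  `[(t%:R - (n.+1 * i.+1)%:R) / i.+1%:R - (i.+1%:R * (scale j.+1)%:R)^-1,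
    (t%:R - (n.+1 * i.+1)%:R) / i.+1%:R + (i.+1%:R * (scale j.+1)%:R)^-1].

Definition gap_row (n j i : nat) : set R :=
  \big[setU/set0]_(t < (2 * (n.+1 * i.+1)).+1) gap_itv n j i t.

Definition gap_set (n j : nat) : set R :=
  \big[setU/set0]_(i < scale j) gap_row n j i.

Lemma measurable_gap_itv n j i t : measurable (gap_itv n j i t).
Proof. exact: measurable_itv. Qed.

Lemma measurable_gap_row n j i : measurable (gap_row n j i).
Proof. by apply: bigsetU_measurable => t _; exact: measurable_gap_itv. Qed.

Lemma measurable_gap_set n j : measurable (gap_set n j).
Proof. by apply: bigsetU_measurable => i _; exact: measurable_gap_row. Qed.

Lemma measure_gap_row n j i :
  (lebesgue_measure (gap_row n j i) <= (6 * n.+1%:R / (scale j.+1)%:R)%:E)%E.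
Proof.
apply: (le_trans (Boole_inequality (@lebesgue_measure R) _)).
  by move=> t _; exact: measurable_gap_itv.
have B0 : 0 < (scale j.+1)%:R :> R by rewrite ltr0n scale_gt0.
have i0 : 0 < i.+1%:R :> R by rewrite ltr0n.
pose d : R := (i.+1%:R * (scale j.+1)%:R)^-1.
have d0 : 0 < d by rewrite invr_gt0 mulr_gt0.
have mu_itv t : lebesgue_measure (gap_itv n j i t) = (d + d)%:E.
  rewrite lebesgue_measure_itv/= lte_fin ltrD2l -/d gt0_cp// -EFinB.
  by congr EFin; ring.
rewrite (eq_bigr (fun=> (d + d)%:E)); last by move=> t _; exact: mu_itv.
rewrite sumEFin lee_fin sumr_const card_ord -[leLHS]mulr_natr.
have -> : 6 * n.+1%:R / (scale j.+1)%:R = (d + d) * (3 * (n.+1 * i.+1))%:R.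
  rewrite /d (natrM _ 3) (natrM _ n.+1); move: (scale _)%:R i.+1%:R B0 i0 => B q B0 q0.
  by field; rewrite !gt_eqF.
rewrite ler_pM2l ?addr_gt0// ler_nat.
by rewrite (mulnDl 2 1) mul1n -addn1 leq_add2l muln_gt0.
Qed.

Lemma measure_gap_set n j :
  (lebesgue_measure (gap_set n j) <= (6 * n.+1%:R * j.+2%:R^-1 ^+ 2)%:E)%E.
Proof.
apply: (le_trans (Boole_inequality (@lebesgue_measure R) _)).
  by move=> i _; exact: measurable_gap_row.
apply: (@le_trans _ _ (\sum_(i < scale j) (6 * n.+1%:R / (scale j.+1)%:R)%:E)%E).
  by apply: lee_sum => i _; exact: measure_gap_row.
rewrite sumEFin lee_fin sumr_const card_ord scaleS (natrM _ (_ ^ 2)) natrX -[leLHS]mulr_natr.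
rewrite le_eqVlt; apply/orP; left; apply/eqP.
have : (scale j)%:R != 0 :> R by rewrite pnatr_eq0 -lt0n scale_gt0.
have : j.+2%:R != 0 :> R by rewrite pnatr_eq0.
move: (scale j)%:R j.+2%:R n.+1%:R => A r m r0 A0.
by field; rewrite r0 A0.
Qed.

End gap_sets.

Lemma ae_notin_gap_set (R : realType) (n : nat) :
  {ae @lebesgue_measure R, forall xi,
    exists j0, forall j, (j0 <= j)%N -> ~ gap_set n j xi}.
Proof.
exists (lim_sup_set (@gap_set R n)); split.
- apply: bigcap_measurable => // k _; apply: bigcup_measurable => j _.
  exact: measurable_gap_set.
- apply: lim_sup_set_cvg0; first by move=> k; exact: measurable_gap_set.
  apply: (@le_lt_trans _ _ (6 * n.+1%:R)%:E); last exact: ltry.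
  apply: lime_le; first by apply: is_cvg_nneseries => *; exact: measure_ge0.
  apply: nearW => N.
  apply: (@le_trans _ _ (\sum_(0 <= j < N) (6 * n.+1%:R * j.+2%:R^-1 ^+ 2)%:E)%E).
    by apply: lee_sum => j _; exact: measure_gap_set.
  rewrite sumEFin lee_fin -mulr_sumr -[leRHS]mulr1 ler_pM2l ?mulr_gt0//.
  have := @sum_inv_sqr_le R N.+1; rewrite !big_add1 /=.
  by move=> /le_trans; apply; lra.
- move=> xi /= /forallNP h k _.
  have /existsNP[j /not_implyP[kj /contrapT xj]] := h k.
  by exists j.
Qed.

Section slow_denominators.
Context {R : realType} (xi : R) (xi_irr : irrational xi).

Lemma denn_no_jump (n j k : nat) : `|xi| <= n%:R -> ~ gap_set n j xi ->
  (convergent_denn xi k <= scale j)%N -> (convergent_denn xi k.+1 < scale j.+1)%N.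
Proof.
move=> xin ngap qj; rewrite ltnNge; apply/negP => qS; apply: ngap.
set q := convergent_denn xi k in qj.
have q0 : (0 < q)%N by exact: convergent_denn_gt0.
have Q0 : 0 < q%:R :> R by rewrite ltr0n.
have B0 : 0 < (scale j.+1)%:R :> R by rewrite ltr0n scale_gt0.
set p := numq (convergent xi k).
have approx : `|xi - p%:~R / q%:R| <= (q%:R * (scale j.+1)%:R)^-1.
  apply: (le_trans (convergent_denn_approx xi_irr k)).
  rewrite lef_pV2 ?posrE ?mulr_gt0 ?ltr0n ?convergent_denn_gt0 ?scale_gt0//.
  by rewrite ler_pM2l// ler_nat.
have pq : `|p| <= (n.+1 * q)%N%:Z.
  rewrite -(ler_int R) intr_norm -pmulrn natrM -ler_pdivrMr//.
  rewrite -[X in _ / X](gtr0_norm Q0) -normf_div -[p%:~R / _](subKr xi).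
  apply: (le_trans (ler_normB _ _)); rewrite -natr1 lerD//.
  apply: (le_trans approx); rewrite invf_le1 ?mulr_gt0// -natrM ler1n.
  by rewrite muln_gt0 q0 scale_gt0.
have qi : (q.-1 < scale j)%N by rewrite prednK.
pose t := `|(p + (n.+1 * q)%N%:Z)%R|%N.
have tE : t%:Z = p + (n.+1 * q)%N%:Z.
  by rewrite /t gez0_abs// -lerBlDr sub0r; move: pq; rewrite ler_norml => /andP[].
have tlt : (t < (2 * (n.+1 * q.-1.+1)).+1)%N.
  rewrite ltnS -lez_nat tE prednK// mul2n -addnn PoszD lerD2r.
  by move: pq; rewrite ler_norml => /andP[].
rewrite /gap_set -(bigcup_mkord _ (gap_row n j)); exists q.-1 => //=.
rewrite /gap_row -(bigcup_mkord _ (gap_itv n j q.-1)); exists t => //=.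
have tR : t%:R - (n.+1 * q)%:R = p%:~R :> R.
  by rewrite [t%:R]pmulrn tE intrD -pmulrn addrK.
rewrite /gap_itv prednK//= in_itv /= -ler_distl tR.
exact: approx.
Qed.

End slow_denominators.

(** * Divergence of the series *)

Section loglog.
Context {R : realType}.

Lemma ln_natr_gt0 (r : nat) : (1 < r)%N -> 0 < ln r%:R :> R.
Proof. by move=> r1; rewrite ln_gt0// ltr1n. Qed.

(** Twice $\log z \le z - 1$, at $z = \log (r + 1) / \log r$ and at
    $z = (r + 1) / r$. *)
Lemma ln_ln_step (r : nat) : (1 < r)%N ->
  ln (ln r.+1%:R) - ln (ln r%:R) <= (r%:R * ln r%:R)^-1 :> R.
Proof.
move=> r1; have L0 := ln_natr_gt0 r1.
have L1 : 0 < ln r.+1%:R :> R by apply: ln_natr_gt0; exact: ltnW.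
have r0 : 0 < r%:R :> R by rewrite ltr0n ltnW.
have sub1 (z : R) : 0 < z -> ln z <= z - 1.
  by move=> z0; rewrite -{1}[z](subrKC 1); apply: le_ln1Dx; rewrite ltrBrDl subrr.
rewrite -ln_div ?posrE//; apply: (le_trans (sub1 _ (divr_gt0 L1 L0))).
have h : ln r.+1%:R - ln r%:R <= r%:R^-1 :> R.
  have q0 : 0 < r.+1%:R / r%:R :> R by rewrite divr_gt0.
  rewrite -ln_div ?posrE//; apply: (le_trans (sub1 _ q0)).
  by rewrite -natr1 mulrDl divff ?gt_eqF// mul1r addrAC subrr add0r.
rewrite invfM -[X in _ / _ - X](divff (lt0r_neq0 L0)) -mulrBl.
by rewrite ler_pM2r// invr_gt0.
Qed.

Lemma ln_ln_le_sum (r N : nat) : (1 < r)%N ->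
  ln (ln (r + N)%:R) - ln (ln r%:R) <=
  \sum_(0 <= i < N) ((r + i)%:R * ln (r + i)%:R)^-1 :> R.
Proof.
move=> r1; elim: N => [|N IH]; first by rewrite addn0 subrr big_geq.
have rN : (1 < r + N)%N by rewrite (leq_trans r1)// leq_addr.
rewrite big_nat_recr//=; apply: le_trans (lerD IH (ln_ln_step rN)).
by rewrite addnS [leRHS]addrC subrKA.
Qed.

Lemma sum_inv_mul_ln_unbounded (r : nat) (L : R) : (1 < r)%N ->
  exists N, L < \sum_(0 <= i < N) ((r + i)%:R * ln (r + i)%:R)^-1.
Proof.
move=> r1; pose x : R := expR (expR (L + ln (ln r%:R))).
exists (Num.truncn x).+1; apply: lt_le_trans (ln_ln_le_sum _ r1).
rewrite ltrBrDr -[ltLHS]expRK ltr_ln ?posrE ?expR_gt0//; last first.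
  by apply: ln_natr_gt0; rewrite (leq_trans r1)// leq_addr.
rewrite -[ltLHS]expRK ltr_ln ?posrE ?expR_gt0 ?ltr0n ?addnS// -/x.
apply: (lt_le_trans (truncnS_gt x)).
by rewrite ler_nat -addnS leq_addl.
Qed.

(** $(j + 2)! \le (j + 2)^{j + 2}$; the maximum with 1 is absorbed because
    $\log r \ge 1 - 1 / r \ge 1 / 2$. *)
Lemma max1_ln_scale (j : nat) :
  Num.max 1 (ln (scale j.+1)%:R) <= 2 * (j.+2%:R * ln j.+2%:R) :> R.
Proof.
have L0 : 0 < ln j.+2%:R :> R by apply: ln_natr_gt0.
have fl : (j.+2)`!%:R <= j.+2%:R ^+ j.+2 :> R.
  rewrite -natrX ler_nat; elim: j.+2 => // m IH.
  rewrite factS expnS leq_mul//; apply: (leq_trans IH).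
  by case: m {IH} => // m; rewrite leq_exp2r.
rewrite ge_max; apply/andP; split.
  have h : 2^-1 <= ln j.+2%:R :> R.
    rewrite -[ln _]opprK -lnV ?posrE// lerNr.
    have -> : j.+2%:R^-1 = 1 + (j.+2%:R^-1 - 1) :> R by rewrite subrKC.
    apply: (le_trans (le_ln1Dx _)).
      by rewrite ltrBrDl subrr invr_gt0.
    rewrite lerBlDr (_ : - 2^-1 + 1 = 2^-1); last by field.
    by rewrite lef_pV2 ?posrE// ler_nat.
  have j2 : 2 <= j.+2%:R :> R by rewrite ler_nat.
  have : 2 * 2^-1 <= j.+2%:R * ln j.+2%:R :> R by rewrite ler_pM.
  lra.
rewrite /scale natrX lnXn ?ltr0n ?fact_gt0// -[leLHS]mulr_natl ler_pM2l//.
apply: (@le_trans _ _ (ln (j.+2%:R ^+ j.+2))).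
  by rewrite ler_ln ?posrE ?exprn_gt0 ?ltr0n ?fact_gt0.
by rewrite lnXn// mulr_natl.
Qed.

End loglog.

Section divergence.
Context {R : realType} (xi : R) (xi_irr : irrational xi).

Let S := series (inv_log_den xi).

Lemma inv_log_den_gt0 k : 0 < inv_log_den xi k.
Proof. by rewrite invr_gt0 lt_max ltr01. Qed.

Lemma inv_log_den_ge k j : (convergent_denn xi k <= scale j.+1)%N ->
  (2 * (j.+2%:R * ln j.+2%:R))^-1 <= inv_log_den xi k.
Proof.
move=> qj; have d0 : 0 < convergent_den xi k by exact: denq_gt0.
have M0 (z : R) : 0 < Num.max 1 z by rewrite lt_max ltr01.
apply: (@le_trans _ _ (Num.max 1 (ln (scale j.+1)%:R))^-1).
  rewrite lef_pV2 ?posrE//; first exact: max1_ln_scale.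
  exact: lt_le_trans (max1_ln_scale j).
rewrite lef_pV2 ?posrE//; apply: le_max2 => //.
rewrite ler_ln ?posrE ?ltr0z ?ltr0n ?scale_gt0//.
by rewrite [leRHS]pmulrn ler_int; rewrite -convergent_dennE lez_nat.
Qed.

(** One denominator between any two consecutive scales from [j0] on; as the
    denominators do not decrease, these are different terms of the series. *)
Lemma series_ge_scales (j0 : nat) :
  (forall j k, (j0 <= j)%N -> (convergent_denn xi k <= scale j)%N ->
     (convergent_denn xi k.+1 < scale j.+1)%N) ->
  (convergent_denn xi 0 <= scale j0)%N ->
  forall N, exists k,
    [/\ (scale (j0 + N) < convergent_denn xi k)%N, (convergent_denn xi k < scale (j0 + N).+1)%N &
      \sum_(0 <= i < N.+1)
        (2 * ((j0 + i).+2%:R * ln (j0 + i).+2%:R))^-1 <= S k.+1].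
Proof.
move=> no_jump q0.
have q_mono := convergent_denn_mono xi_irr.
have hit N : exists k, (scale (j0 + N) < convergent_denn xi k)%N &&
    (convergent_denn xi k < scale (j0 + N).+1)%N.
  have exk : exists k, (scale (j0 + N) < convergent_denn xi k)%N.
    by exists (scale (j0 + N)).+1; exact: convergent_denn_ge.
  case: (ex_minnP exk) => -[|k] qk kmin.
    have : (scale j0 <= scale (j0 + N))%N.
      by rewrite leq_exp2r// leq_fact// ltnS leq_addr.
    by rewrite leqNgt (leq_trans qk q0).
  exists k.+1; rewrite qk no_jump ?leq_addr// leqNgt.
  by apply/negP => /kmin; rewrite ltnn.
elim=> [|N [k [qk1 qk2 Sk]]].
  have [k /andP[qk1 qk2]] := hit 0%N; exists k; split=> //.
  rewrite big_nat1 /S /series /= big_nat_recr//= -[leLHS]add0r lerD//.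
    by apply: sumr_ge0 => i _; rewrite ltW// inv_log_den_gt0.
  by rewrite addn0 in qk1 qk2 *; rewrite inv_log_den_ge// ltnW.
have [k' /andP[qk1' qk2']] := hit N.+1; exists k'; split=> //.
have kk' : (k < k')%N.
  rewrite ltnNge; apply/negP => /q_mono; rewrite leqNgt => /negP; apply.
  by apply: (leq_trans qk2); rewrite -addnS ltnW.
rewrite big_nat_recr//= /S /series /= [leRHS]big_nat_recr//=.
apply: lerD; last by rewrite inv_log_den_ge// ltnW.
apply: (le_trans Sk); rewrite /S /series /= [leRHS](big_cat_nat (leq0n _) kk')/=.
by rewrite lerDl; apply: sumr_ge0 => i _; rewrite ltW// inv_log_den_gt0.
Qed.

Lemma dvg_inv_log_den (n j0 : nat) : `|xi| <= n%:R ->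
  (forall j, (j0 <= j)%N -> ~ gap_set n j xi) -> ~ cvgn S.
Proof.
move=> xin nogap cS.
pose j1 := (j0 + convergent_denn xi 0)%N.
have no_jump j k : (j1 <= j)%N -> (convergent_denn xi k <= scale j)%N ->
    (convergent_denn xi k.+1 < scale j.+1)%N.
  move=> jj; apply: (denn_no_jump xi_irr xin); apply: nogap.
  by apply: leq_trans jj; rewrite leq_addr.
have q0 : (convergent_denn xi 0 <= scale j1)%N.
  apply: (@leq_trans j1); first by rewrite leq_addl.
  have le_fact m : (m <= m`!)%N by elim: m => // m IH; rewrite factS leq_pmulr// fact_gt0.
  apply: (leq_trans (leqnSn j1)); apply: (leq_trans (le_fact _)).
  by rewrite /scale -{1}[_`!]expn1 leq_pexp2l// fact_gt0.
have [N] := @sum_inv_mul_ln_unbounded R j1.+2 (2 * limn S) isT.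
have [k [_ _ Sk]] := series_ge_scales no_jump q0 N.
have S_mono : nondecreasing_seq S.
  by apply: nondecreasing_series => i _ _; rewrite ltW// inv_log_den_gt0.
have Slim := nondecreasing_cvgn_le S_mono cS k.+1.
apply/negP; rewrite -leNgt.
have h : \sum_(0 <= i < N.+1) ((j1.+2 + i)%:R * ln (j1.+2 + i)%:R)^-1 <= 2 * S k.+1.
  rewrite -ler_pdivrMl// mulr_sumr; apply: le_trans Sk.
  rewrite le_eqVlt; apply/orP; left; apply/eqP; apply: eq_bigr => i _.
  by rewrite !addSn [in RHS]invfM.
have h' : 2 * S k.+1 <= 2 * limn S by rewrite ler_pM2l.
apply: (le_trans _ (le_trans h h')).
by rewrite [leRHS]big_nat_recr//= lerDl invr_ge0 mulr_ge0// ln_ge0// ler1n.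
Qed.

End divergence.

Lemma ae_dvg_inv_log_den (R : realType) :
  {ae @lebesgue_measure R, forall xi : R, ~ cvgn (series (inv_log_den xi))}.
Proof.
pose F := ae_filter_ringOfSetsType (@lebesgue_measure R).
have irr : {ae @lebesgue_measure R, forall xi : R, irrational xi}.
  have rat_countable : countable (@rational R).
    exact: (card_le_trans (card_image_le _ _) (countableP _)).
  exists (@rational R); split.
  - by apply: (countable_measurable _ rat_countable) => t; exact: measurable_set1.
  - exact: countable_lebesgue_measure0.
  - by move=> x /= /contrapT.
apply: (@filterS2 _ _ F _ _ _ _ irr
  (ae_foralln (fun n => @ae_notin_gap_set R n))) => xi xi_irr gap.
have [j0 nogap] := gap (Num.truncn `|xi|).+1.
by apply: (dvg_inv_log_den xi_irr _ nogap); rewrite ltW// truncnS_gt.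
Qed.

Theorem theorem3 (R : realType) :
  (forall xi : R, irrational xi ->
     ~ cvgn (series (inv_log_den xi)) ->
     {ae @lebesgue_measure R, forall y : R,
        infinite_set [set pq : int * int |
          [/\ primitive_point pq, pq.2 != 0
            & `|pq.2%:~R * xi + pq.1%:~R - y| <= 2 / `|pq.2%:~R| ]]}) /\
  {ae @lebesgue_measure R, forall xi : R, ~ cvgn (series (inv_log_den xi))}.
Proof.
split; last exact: ae_dvg_inv_log_den.
move=> xi xi_irr _.
apply: (@filterS _ _ (ae_filter_ringOfSetsType (@lebesgue_measure R)) _ _ _
  (ae_foralln (fun T => ae_approximable T xi_irr))).
by move=> y; exact: approximable_infinite.
Qed.
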